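(* Let $m$ be a positive integer, let $x(t)$ be a (complex-valued) continuous-time signal for which the convolutions below are defined, and let $\rho^m_d[n]$ be a proper discrete-time signal that vanishes for all $n\le 0$ and all $n\ge m+1$. Let $\rho^m\in\chi^m(\rho^m_d)$, and put $$v_p:=(x_p*\overline{x_p})*\big[(\rho^m_p)^{-1}*(\overline{\rho^m_p})^{-1}\big],\qquad w:=\big[(\overline{\rho^m_p})^{-1}*\overline{x_p}\big]*x,$$ where $v_p(t)=\sum_{n\in\mathbb Z}v_d[n]\delta(t-n)$. For $0\le n\le m$ define $R_n(t):=\rho^m(t+n)$ and $W_n(t):=w(t+n)$ for $0\le t<1$, and $R_n(t):=W_n(t):=0$ otherwise. Then the functional equation $$(v_p*\rho^m)(t)=w(t)\quad\text{for all } t\in(0,m+1)$$ is equivalent to the finite linear system $$\begin{bmatrix} v_d[0] & v_d[-1] & \cdots & v_d[-m] \\ v_d[1] & v_d[0] & \cdots & v_d[-m+1] \\ \vdots & \vdots & \ddots & \vdots \\ v_d[m] & v_d[m-1] & \cdots & v_d[0] \end{bmatrix} \begin{bmatrix} R_0 \\ R_1 \\ \vdots \\ R_m \end{bmatrix} = \begin{bmatrix} W_0 \\ W_1 \\ \vdots \\ W_m \end{bmatrix}$$ (holding pointwise in $t$), the coefficient matrix $V=[v_d[i-j]]_{i,j=1,\dots,m+1}$ is Hermitian, and $\rho^m(t)=\sum_{n=0}^{m}R_n(t-n)$.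
   Context: Signals are complex-valued functions; $*$ between signals denotes convolution, $z^*$ denotes the complex conjugate, and $\overline{y}(t):=y^*(-t)$. Samples: for a continuous-time signal $y(t)$ (sampling period $1$), $y_d[n]:=y(n)$ for $n\in\mathbb Z$ and $y_p(t):=\sum_{n\in\mathbb Z}y_d[n]\,\delta(t-n)$. Thus $y_p$ is an impulse train encoding $y_d$, and convolving a function $g$ with it gives $(y_p*g)(t)=\sum_n y_d[n]g(t-n)$. Similarly, $\rho^m_p(t):=\sum_n\rho^m_d[n]\delta(t-n)$. Proper signal: a discrete-time signal $y_d[n]$ is proper if it is bounded and has a unique and bounded convolution inverse $y_d^{-1}[n]$ (i.e. $(y_d*y_d^{-1})[n]$ equals $1$ for $n=0$ and $0$ otherwise). Then $(y_p)^{-1}(t):=\sum_n y_d^{-1}[n]\delta(t-n)$, so $(y_p)^{-1}*y_p=\delta$. The class $D$: all continuous-time signals $y$ that have finitely many extrema in any given interval, have finitely many discontinuities in any given interval, are absolutely integrable over a period (for the compactly supported functions considered here: over their support), and are bounded. The set $\chi^m(\rho^m_d)$: all continuous-time signals $y$ with (1) $y\in D$; (2) $y(n)=\rho^m_d[n]$ for all $n\in\mathbb N$; (3) $y(t)=0$ for all $t\notin(0,m+1)$. *)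

(* Defs.v *)
From HB Require Import structures.
From mathcomp Require Import all_boot all_order all_algebra.
From mathcomp Require Import all_classical all_reals all_analysis.
From mathcomp Require Import complex.
From mathcomp Require summability.
Set Implicit Arguments.
Unset Strict Implicit.
Unset Printing Implicit Defensive.
Import Order.TTheory GRing.Theory Num.Theory.
Import numFieldNormedType.Exports.
Import ComplexField.Normc.
Local Open Scope classical_set_scope.
Local Open Scope ring_scope.

(* An impulse train sum_n y[n] delta(t - n) is represented by its coefficient
   sequence y : int -> R[i]; convolution of two trains is then [dconv], and
   convolution of a train with a function of time is [train_conv]. *)

Section signals.
Context {R : realType}.
Local Notation C := R[i].

Definition zsummable (f : int -> C) : Prop :=
  summable [set: int] (fun k => (normc (f k))%:E).

(* Unordered sum (limit along finite subsets of int). The topology of R[i] as a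
   normed field is carried by the alias (R[i])^o. *)
Definition zsum (f : int -> C) : C :=
  summability.sum (f : int -> C^o).

Definition dconv (y z : int -> C) (n : int) : C :=
  zsum (fun k => y k * z (n - k)).

Definition dconv_defined (y z : int -> C) : Prop :=
  forall n : int, zsummable (fun k => y k * z (n - k)).

Definition train_conv (y : int -> C) (g : R -> C) (t : R) : C :=
  zsum (fun n => y n * g (t - n%:~R)).

Definition train_conv_defined (y : int -> C) (g : R -> C) : Prop :=
  forall t : R, zsummable (fun n => y n * g (t - n%:~R)).

Definition samples (y : R -> C) : int -> C := fun n => y n%:~R.

(* The conjugate reversal y^*(-t). On a train it acts on the coefficients,
   since delta is real and even. *)
Definition conj_rev {T : zmodType} (y : T -> C) : T -> C := fun t => (y (- t))^*.

Definition bounded_signal {T : Type} (y : T -> C) : Prop :=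
  exists M : R, forall t, normc (y t) <= M.

Definition bounded_inverse (y z : int -> C) : Prop :=
  [/\ bounded_signal z, dconv_defined y z
    & dconv y z = fun n => (n == 0)%:R].

(* Uniqueness is among bounded sequences: a finitely supported y with at least
   two nonzero terms always has several (unbounded) one-sided inverses. *)
Definition proper_signal (y : int -> C) : Prop :=
  bounded_signal y /\ exists! z, bounded_inverse y z.

(* The bounded convolution inverse; 0 by convention if there is none. *)
Definition conv_inv (y : int -> C) : int -> C :=
  xget (fun=> 0) [set z | bounded_inverse y z].

(* A local maximum of f attained exactly on [a, b]: a strict one if a = b, a
   flat one if a < b. Intervals of constancy thus count as one extremum rather
   than infinitely many, so that a compactly supported function can have
   finitely many extrema. *)
Definition maximum_on (f : R -> R) (a b : R) : Prop :=
  [/\ a <= b, forall t, a <= t <= b -> f t = f a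
    & exists2 e : R, 0 < e &
        forall t, (a - e < t < a) || (b < t < b + e) -> f t < f a].

Definition extremum_on (f : R -> R) (a b : R) : Prop :=
  maximum_on f a b \/ maximum_on (\- f) a b.

Definition finitely_many_extrema (f : R -> R) : Prop :=
  forall c d : R,
    finite_set [set p : R * R | [/\ c <= p.1, p.2 <= d & extremum_on f p.1 p.2]].

Definition finitely_many_discontinuities (y : R -> C) : Prop :=
  forall c d : R,
    finite_set [set t : R | c <= t <= d /\ ~ {for t, continuous (y : R -> C^o)}].

(* The extrema of a complex-valued signal are those of its two components. *)
Definition class_D (y : R -> C) : Prop :=
  [/\ finitely_many_extrema (fun t => complex.Re (y t))
        /\ finitely_many_extrema (fun t => complex.Im (y t)),
      finitely_many_discontinuities y,
      (@lebesgue_measure R).-integrable (closure [set t | y t != 0])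
        (fun t => (normc (y t))%:E)
    & bounded_signal y].

Definition chi (m : nat) (rho_d : int -> C) : set (R -> C) :=
  [set y | [/\ class_D y,
               forall n : nat, y n%:R = rho_d n%:Z
             & forall t : R, ~~ (0 < t < m.+1%:R) -> y t = 0]].

Definition time_slice (f : R -> C) (n : nat) (t : R) : C :=
  if 0 <= t < 1 then f (t + n%:R) else 0.

(* 'I_m.+1 starts at 0, which leaves the differences i - j unchanged. *)
Definition toeplitz (m : nat) (v : int -> C) : 'M[C]_m.+1 :=
  \matrix_(i, j) v (i%:Z - j%:Z).

End signals.

(* Main.v *)
Require Import Defs.
From mathcomp Require Import all_boot all_order all_algebra.
From mathcomp Require Import all_classical all_reals all_analysis.
From mathcomp Require Import complex.
From mathcomp Require Import finmap ring lra zify.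
From mathcomp Require summability.
Set Implicit Arguments.
Unset Strict Implicit.
Unset Printing Implicit Defensive.
Import Order.TTheory GRing.Theory Num.Theory.
Import numFieldNormedType.Exports.
Import ComplexField.Normc.
Local Open Scope classical_set_scope.
Local Open Scope ring_scope.

(* Since [rho] vanishes off (0, m + 1), evaluating (v_p * rho)(t + i) for t in
   [0, 1) leaves exactly the i-th row of the Toeplitz system, so the two systems
   of equations differ only by the row 0 at t = 0. That equation,
   (v_d * rho_d)[0] = w(0), is an instance of associativity of the convolutions
   and needs absolute convergence. Uniqueness of the bounded inverse of [rho_d]
   excludes zeros on the unit circle of the polynomial sum_k rho_d[k] X^k;
   dividing by its linear factors X - z one at a time then shows that the inverse
   is absolutely summable. As [x_d] is square summable (its autocorrelation is
   defined at 0), Fubini applies. *)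

(** * Unordered sums of complex families over the integers, up to Fubini *)

Section Sums.
Context {R : realType}.
Local Open Scope complex_scope.
Local Notation C := R[i].
Implicit Types (f g : int -> C) (s : C).

#[local] Existing Instance summability.totally_filter.

Lemma normC_normc (z : C) : `|z| = (normc z)%:C.
Proof. by case: z. Qed.

Lemma normc_ge0 (z : C) : 0 <= normc z.
Proof. by case: z => a b; exact: sqrtr_ge0. Qed.

Lemma normc_conj (z : C) : normc z^*%R = normc z.
Proof. by case: z => a b /=; rewrite sqrrN. Qed.

Lemma normc_opp (z : C) : normc (- z) = normc z.
Proof. by case: z => a b /=; rewrite !sqrrN. Qed.

Lemma normcD_le (y z : C) : normc (y + z) <= normc y + normc z.
Proof. exact: le_normcD. Qed.

Lemma normc_real (r : R) : 0 <= r -> normc r%:C = r.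
Proof. by move=> r0; rewrite /= expr0n addr0 sqrtr_sqr ger0_norm. Qed.

Lemma normc_sum (I : Type) (r : seq I) (F : I -> C) :
  normc (\sum_(i <- r) F i) <= \sum_(i <- r) normc (F i).
Proof.
elim/big_rec2: _ => [|i b z _ h]; first by rewrite normc0.
by rewrite (le_trans (normcD_le _ _))// lerD2l.
Qed.

Lemma normc_Re (z : C) : - normc z <= complex.Re z <= normc z.
Proof.
by have := normc_ge_Re z; rewrite normC_normc lecR -ler_norml.
Qed.

Lemma normc_Im (z : C) : - normc z <= complex.Im z <= normc z.
Proof.
rewrite -ler_norml; case: z => a b /=.
by rewrite -sqrtr_sqr ler_wsqrtr// lerDr sqr_ge0.
Qed.

(** Since [zsum] is a limit, with a default value when there is none, sums are handled through this
    relation, which includes convergence. *)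
Definition has_zsum f s : Prop :=
  summability.partial_sum (f : int -> C^o) @ summability.totally --> (s : C^o).

Lemma has_zsum_zsum f s : has_zsum f s -> zsum f = s.
Proof. by move=> fs; apply: (@cvg_lim C^o) => //; exact: norm_hausdorff. Qed.

Lemma partial_sumE (f : int -> C) A :
  summability.partial_sum f A = \sum_(i <- A) f i.
Proof. by rewrite /summability.partial_sum big_seq_fsetE. Qed.

(** The norm of [C^o] is itself complex-valued; a positive radius is real, which brings all
    estimates back to [normc] in [R]. *)
Lemma has_zsumP f s : has_zsum f s <-> (forall e : R, 0 < e ->
  exists A : {fset int}, forall B : {fset int}, (A `<=` B)%fset ->
    normc (s - \sum_(i <- B) f i) < e).
Proof.
split=> [fs e e0|h].
  move/cvgrPdist_lt : fs => /(_ e%:C); rewrite ltcR => /(_ e0)[A _ hA].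
  exists A => B /hA /=; rewrite partial_sumE.
  by rewrite normC_normc ltcR.
apply/cvgrPdist_lt => e e0.
have eE : e = (complex.Re e)%:C by rewrite RRe_real// gtr0_real.
move: e0; rewrite eE ltcR => /h[A hA].
exists A => // B /hA /=; rewrite partial_sumE.
by rewrite normC_normc ltcR.
Qed.

Lemma has_zsumD f g s t : has_zsum f s -> has_zsum g t ->
  has_zsum (fun k => f k + g k) (s + t).
Proof.
move=> fs gt; rewrite /has_zsum.
have -> : summability.partial_sum (fun k => f k + g k : C^o) =
    summability.partial_sum (f : int -> C^o) \+ summability.partial_sum (g : int -> C^o).
  by apply/funext => A /=; rewrite !partial_sumE -big_split.
exact: (cvgD fs gt).
Qed.

Lemma has_zsumZ c f s : has_zsum f s -> has_zsum (fun k => c * f k) (c * s).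
Proof.
move=> fs; rewrite /has_zsum.
have -> : summability.partial_sum (fun k => c * f k : C^o) =
    (fun A => (c : C^o) *: summability.partial_sum (f : int -> C^o) A).
  by apply/funext => A /=; rewrite !partial_sumE scaler_sumr.
exact: cvgZl_tmp fs.
Qed.

Lemma eq_has_zsum f g s : f =1 g -> has_zsum f s -> has_zsum g s.
Proof. by move=> /funext ->. Qed.

Lemma has_zsum_conj f s : has_zsum f s -> has_zsum (fun k => (f k)^*%R) s^*%R.
Proof.
move=> /has_zsumP fs; apply/has_zsumP => e /fs[A hA]; exists A => B /hA.
by rewrite -rmorph_sum -rmorphB normc_conj.
Qed.

Lemma has_zsum_fin f (A : {fset int}) :
  (forall k, k \notin A -> f k = 0) -> has_zsum f (\sum_(i <- A) f i).
Proof.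
move=> fA; apply/has_zsumP => e e0; exists A => B AB.
rewrite (big_fset_incl _ AB) ?subrr ?normc0// => k _ /fA.
by [].
Qed.

Lemma has_zsum_reindex f s (u v : int -> int) : cancel u v -> cancel v u ->
  has_zsum f s -> has_zsum (f \o u) s.
Proof.
move=> uv vu /has_zsumP fs; apply/has_zsumP => e /fs[A hA].
exists [fset v k | k in A]%fset => B AB.
have -> : \sum_(i <- B) (f \o u) i = \sum_(i <- [fset u k | k in B]%fset) f i.
  by rewrite big_imfset//= => i j _ _ /(can_inj uv).
apply: hA; apply/fsubsetP => k kA; apply/imfsetP; exists (v k) => //=.
by apply: (fsubsetP AB); rewrite in_imfset.
Qed.

(** [esum] is a supremum of finite partial sums: one of them comes within [e] of it, and by
    monotonicity so do all larger ones. *)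
Lemma has_zsum_nneg (g : int -> R) : (forall k, 0 <= g k) ->
  (\esum_(k in [set: int]) (g k)%:E < +oo)%E ->
  has_zsum (fun k => (g k)%:C) (fine (\esum_(k in [set: int]) (g k)%:E))%:C.
Proof.
move=> g0 goo; set S := esum _ _ in goo *.
have S0 : (0 <= S)%E by apply: esum_ge0 => k _; rewrite lee_fin.
have Sfin : S \is a fin_num by rewrite ge0_fin_numE.
have sumE (B : {fset int}) : (\sum_(i \in [set` B]) (g i)%:E = (\sum_(i <- B) g i)%:E)%E.
  by rewrite fsbig_finite//= set_fsetK sumEFin.
have SB (B : {fset int}) : \sum_(i <- B) g i <= fine S.
  rewrite -lee_fin fineK// -sumE; apply: ereal_sup_ubound.
  by exists [set` B] => //; split.
apply/has_zsumP => e e0.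
have : ((fine S - e)%:E < S)%E by rewrite -[ltRHS]fineK// lte_fin; lra.
move=> /ereal_sup_gt[_ [X [finX _] <-]].
rewrite fsbig_finite//= sumEFin lte_fin; set A := fset_set X => hA.
exists A => B AB.
have AleB : \sum_(i <- A) g i <= \sum_(i <- B) g i.
  rewrite -lee_fin -!sumE; apply: lee_fsum_nneg_subset.
  - exact: finite_fset.
  - exact: finite_fset.
  - by move=> k /set_mem kA; apply: mem_set; exact: (fsubsetP AB).
  - by move=> k _; rewrite lee_fin.
rewrite -rmorph_sum -rmorphB normc_real ?subr_ge0//; lra.
Qed.


Lemma zsummableE f :
  zsummable f <-> (\esum_(k in [set: int]) (normc (f k))%:E < +oo)%E.
Proof.
rewrite /zsummable /summable; under eq_esum do
  rewrite abse_EFin ger0_norm ?normc_ge0//.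
by [].
Qed.

Lemma zsummable_le f (b : int -> R) : (forall k, normc (f k) <= b k) ->
  (\esum_(k in [set: int]) (b k)%:E < +oo)%E -> zsummable f.
Proof.
move=> fb boo; apply/zsummableE; apply: le_lt_trans boo.
by apply: le_esum => k _; rewrite lee_fin.
Qed.

Lemma esum_section (F : int -> int -> \bar R) k :
  (forall i j, 0 <= F i j)%E ->
  (\esum_(j in [set: int]) F k j <=
    \esum_(i in [set: int]) \esum_(j in [set: int]) F i j)%E.
Proof.
move=> F0; apply: esum_ge; exists [set k]; first by split.
by rewrite fsbig_set1.
Qed.

(** Both iterated sums equal a sum over pairs, and swapping the coordinates matches the two. *)
Lemma esum_exchange (F : int -> int -> \bar R) : (forall i j, 0 <= F i j)%E ->
  \esum_(i in [set: int]) \esum_(j in [set: int]) F i j =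
  \esum_(j in [set: int]) \esum_(i in [set: int]) F i j.
Proof.
move=> F0; rewrite (esum_esum (J := fun _ => [set: int]))//.
rewrite (esum_esum (J := fun _ => [set: int]) (a := fun j i => F i j))//.
rewrite (reindex_esum ([set: int] `*`` fun=> [set: int]) _
  (fun x : int * int => (x.2, x.1)))//; split=> //=.
- by move=> [i1 i2] [j1 j2] /= _ _ [] -> ->.
- by move=> [i1 i2] _ /=; exists (i2, i1).
Qed.

Section NonnegativeParts.
Context (p : C -> R) (p_ge0 : forall z, 0 <= p z)
  (p_le : forall z, p z <= normc z + normc z).

Lemma esum_part_lty f : zsummable f ->
  (\esum_(k in [set: int]) (p (f k))%:E < +oo)%E.
Proof.
move=> /zsummableE foo.
apply: (@le_lt_trans _ _ (\esum_(k in [set: int]) ((normc (f k))%:E + (normc (f k))%:E)))%E.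
  by apply: le_esum => k _; rewrite -EFinD lee_fin.
by rewrite esumD ?lte_add_pinfty// => k _; rewrite lee_fin normc_ge0.
Qed.

Lemma has_zsum_part f : zsummable f ->
  has_zsum (fun k => (p (f k))%:C)
    (fine (\esum_(k in [set: int]) (p (f k))%:E))%:C.
Proof. by move=> /esum_part_lty foo; exact: has_zsum_nneg. Qed.

(** Domination of [p] by twice the norm makes every inner sum finite, so that [fine] loses nothing,
    and then makes the outer sum finite. *)
Lemma has_zsum_part2 (F : int -> int -> C) :
  (\esum_(k in [set: int]) \esum_(j in [set: int]) (normc (F k j))%:E < +oo)%E ->
  has_zsum (fun k => (fine (\esum_(j in [set: int]) (p (F k j))%:E))%:C)
    (fine (\esum_(k in [set: int]) \esum_(j in [set: int]) (p (F k j))%:E))%:C.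
Proof.
move=> Foo; have n0 k j : (0%R <= (normc (F k j))%:E)%E by rewrite lee_fin normc_ge0.
have Fk k : zsummable (F k).
  by apply/zsummableE; apply: le_lt_trans Foo; apply: (esum_section (F := fun i j => (normc (F i j))%:E)).
have pE k : (fine (\esum_(j in [set: int]) (p (F k j))%:E))%:E =
    (\esum_(j in [set: int]) (p (F k j))%:E)%E.
  rewrite fineK// ge0_fin_numE ?esum_part_lty//.
  by apply: esum_ge0 => j _; rewrite lee_fin.
rewrite -(eq_esum (fun k _ => pE k)); apply: has_zsum_nneg => [k|].
  by apply/fine_ge0/esum_ge0 => j _; rewrite lee_fin.
rewrite (eq_esum (fun k _ => pE k)).
apply: (@le_lt_trans _ _ (\esum_(k in [set: int])
   (\esum_(j in [set: int]) (normc (F k j))%:E + \esum_(j in [set: int]) (normc (F k j))%:E)))%E.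
  apply: le_esum => k _; rewrite -esumD//.
  by apply: le_esum => j _; rewrite -EFinD lee_fin.
by rewrite esumD ?lte_add_pinfty// => k _; apply: esum_ge0.
Qed.

End NonnegativeParts.

(* Three nonnegative parts, each at most 2|z|, reduce sums over C to [esum]. *)
Let re_part (z : C) : R := normc z + complex.Re z.
Let im_part (z : C) : R := normc z + complex.Im z.

Let partsE (z : C) :
  z = (re_part z)%:C + 'i%C * (im_part z)%:C + - (1 + 'i%C) * (normc z)%:C.
Proof.
rewrite /re_part /im_part [LHS]complexE !rmorphD /=; ring.
Qed.

Let re_part_ge0 z : 0 <= re_part z.
Proof. by have /andP[+ _] := normc_Re z; rewrite /re_part; lra. Qed.

Let im_part_ge0 z : 0 <= im_part z.
Proof. by have /andP[+ _] := normc_Im z; rewrite /im_part; lra. Qed.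

Let re_part_le z : re_part z <= normc z + normc z.
Proof. by have /andP[_] := normc_Re z; rewrite /re_part; lra. Qed.

Let im_part_le z : im_part z <= normc z + normc z.
Proof. by have /andP[_] := normc_Im z; rewrite /im_part; lra. Qed.

Let normc_le (z : C) : normc z <= normc z + normc z.
Proof. by rewrite lerDl normc_ge0. Qed.

(** The value that the decomposition [partsE] forces on the sum, written with sums of nonnegative
    reals only. *)
Let zsum_parts f : C :=
  (fine (\esum_(k in [set: int]) (re_part (f k))%:E))%:C +
  'i%C * (fine (\esum_(k in [set: int]) (im_part (f k))%:E))%:C +
  - (1 + 'i%C) * (fine (\esum_(k in [set: int]) (normc (f k))%:E))%:C.

Let has_zsum_parts f : zsummable f -> has_zsum f (zsum_parts f).
Proof.
move=> fs; apply: (eq_has_zsum (fun k => esym (partsE (f k)))).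
by apply: has_zsumD; [apply: has_zsumD|]; try apply: has_zsumZ;
  apply: has_zsum_part => //; exact: normc_ge0.
Qed.

Lemma zsummable_has_zsum f : zsummable f -> has_zsum f (zsum f).
Proof. by move=> /has_zsum_parts fs; rewrite (has_zsum_zsum fs). Qed.

(** Each iterated complex sum is the same linear combination of the double sums of the three
    nonnegative parts, and these are exchanged by [esum_exchange]. *)
Lemma zsum_exchange (F : int -> int -> C) :
  (\esum_(k in [set: int]) \esum_(j in [set: int]) (normc (F k j))%:E < +oo)%E ->
  zsum (fun k => zsum (F k)) = zsum (fun j => zsum (F ^~ j)).
Proof.
pose S (p : C -> R) (G : int -> int -> C) :=
  fine (\esum_(k in [set: int]) \esum_(j in [set: int]) (p (G k j))%:E).
have iter (G : int -> int -> C) :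
    (\esum_(k in [set: int]) \esum_(j in [set: int]) (normc (G k j))%:E < +oo)%E ->
    zsum (fun k => zsum (G k)) =
    (S re_part G)%:C + 'i%C * (S im_part G)%:C + - (1 + 'i%C) * (S (@normc R) G)%:C.
  move=> Goo; apply: has_zsum_zsum.
  have Gk k : zsummable (G k).
    apply/zsummableE; apply: le_lt_trans Goo.
    apply: (esum_section (F := fun i j => (normc (G i j))%:E)) => i j.
    by rewrite lee_fin normc_ge0.
  apply: (eq_has_zsum (fun k => esym (has_zsum_zsum (has_zsum_parts (Gk k))))).
  by apply: has_zsumD; [apply: has_zsumD|]; try apply: has_zsumZ;
    apply: has_zsum_part2 => //; exact: normc_ge0.
move=> Foo; rewrite iter// iter; last first.
  by rewrite esum_exchange// => i j; rewrite lee_fin normc_ge0.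
by rewrite /S; congr ((fine _)%:C + 'i%C * (fine _)%:C + _ * (fine _)%:C);
  apply: esum_exchange => i j; rewrite lee_fin ?normc_ge0.
Qed.

End Sums.

(** * Absolute summability through windows of consecutive integers, and operations on sums *)

Section Summability.
Context {R : realType}.
Local Open Scope complex_scope.
Local Notation C := R[i].
Implicit Types (f g y : int -> C).

Lemma sum_iota (V : nmodType) (K : nat) (F : nat -> V) :
  \sum_(i <- iota 0 K) F i = \sum_(i < K) F i.
Proof. by rewrite -(big_mkord xpredT) /index_iota subn0. Qed.

Lemma zsummable_window f : zsummable f ->
  exists B : R, forall (a : int) (K : nat),
    \sum_(i < K) normc (f (a + i%:Z)) <= B.
Proof.
move=> /zsummableE foo; set S := esum _ _ in foo.
have S0 : (0 <= S)%E by apply: esum_ge0 => k _; rewrite lee_fin normc_ge0.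
exists (fine S) => a K; rewrite -lee_fin fineK ?ge0_fin_numE//.
pose s := [seq a + i%:Z | i <- iota 0 K].
have us : uniq s by rewrite map_inj_uniq ?iota_uniq// => i j /addrI[].
apply: esum_ge; exists [set` s].
  by split => //; exact: finite_seq.
rewrite -(@fsbig_seq _ _ _ _ s)// big_map sumEFin lee_fin.
by rewrite sum_iota.
Qed.

(** A finite set of integers lies in a window symmetric about 0, so a bound uniform over windows
    controls the supremum. *)
Lemma esum_window_le (g : int -> R) (B : R) : (forall k, 0 <= g k) ->
  (forall (a : int) (K : nat), \sum_(i < K) g (a + i%:Z) <= B) ->
  (\esum_(k in [set: int]) (g k)%:E <= B%:E)%E.
Proof.
move=> g0 gB; apply: ge_ereal_sup => _ [X [finX _] <-].
rewrite fsbig_finite//= sumEFin lee_fin; set A := fset_set X.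
(* With [N] the largest absolute value in [A], the window from [-N] to [N] has [2N + 1] terms and
   contains [A]. *)
pose N := \max_(k <- A) `|k|%N.
pose s := [seq - N%:Z + i%:Z | i <- iota 0 (N + N).+1].
have us : uniq s by rewrite map_inj_uniq ?iota_uniq// => i j /addrI[].
have As k : k \in A -> k \in s.
  move=> kA; have kN : (`|k| <= N)%N by exact: leq_bigmax_seq.
  apply/mapP; exists (absz (k + N%:Z)%R); last by lia.
  by rewrite mem_iota; lia.
apply: le_trans (gB (- N%:Z) (N + N).+1).
have -> : \sum_(i < (N + N).+1) g (- N%:Z + i%:Z) = \sum_(k <- s) g k.
  by rewrite big_map sum_iota.
rewrite [leRHS](bigID (mem A))/= ler_wpDr//.
  by apply: sumr_ge0 => k _; exact: g0.
rewrite -[leRHS]big_filter [leRHS](perm_big A)//.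
apply: uniq_perm; rewrite ?filter_uniq ?fset_uniq// => k.
by rewrite mem_filter; apply/andP/idP => [[]//|kA]; rewrite kA As.
Qed.

Lemma window_zsummable f (B : R) :
  (forall (a : int) (K : nat), \sum_(i < K) normc (f (a + i%:Z)) <= B) ->
  zsummable f.
Proof.
move=> fB; apply/zsummableE; apply: (@le_lt_trans _ _ B%:E); last exact: ltry.
by apply: esum_window_le => // k; exact: normc_ge0.
Qed.

Lemma zsummableZ c f : zsummable f -> zsummable (fun k => c * f k).
Proof.
move=> /zsummable_window[B fB]; apply: (@window_zsummable _ (normc c * B)) => a K.
under eq_bigr do rewrite normcM.
by rewrite -mulr_sumr ler_wpM2l ?normc_ge0.
Qed.

Lemma zsummableD f g : zsummable f -> zsummable g ->
  zsummable (fun k => f k + g k).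
Proof.
move=> /zsummable_window[B fB] /zsummable_window[D gD].
apply: (@window_zsummable _ (B + D)) => a K.
apply: le_trans (lerD (fB a K) (gD a K)).
by rewrite -big_split; apply: ler_sum => i _; exact: normcD_le.
Qed.

Lemma zsummable_sum (I : Type) (r : seq I) (F : I -> int -> C) :
  (forall i, zsummable (F i)) -> zsummable (fun k => \sum_(i <- r) F i k).
Proof.
move=> Fs; elim: r => [|i r IH].
  apply: (@window_zsummable _ 0) => a K.
  by rewrite big1// => k _; rewrite big_nil normc0.
have := zsummableD (Fs i) IH; congr zsummable.
by apply/funext => k; rewrite big_cons.
Qed.

Lemma zsummable_normc f g : (forall k, normc (f k) = normc (g k)) ->
  zsummable f -> zsummable g.
Proof.
move=> fg /zsummable_window[B fB]; apply: (@window_zsummable _ B) => a K.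
by under eq_bigr do rewrite -fg.
Qed.

Lemma esum_mulC_lty (c : R) f : zsummable f -> 0 <= c ->
  (\esum_(k in [set: int]) (c * normc (f k))%:E < +oo)%E.
Proof.
move=> fs c0; have /zsummableE := zsummableZ c%:C fs.
congr (_ < _)%E.
by apply: eq_esum => k _; rewrite normcM normc_real.
Qed.

Lemma zsummable_bounded f (b : int -> C) : zsummable f -> bounded_signal b ->
  zsummable (fun k => f k * b k).
Proof.
move=> fs [M bM]; have M0 : 0 <= M by apply: le_trans (bM 0); exact: normc_ge0.
apply: (zsummable_le _ (esum_mulC_lty fs M0)) => k.
by rewrite normcM mulrC ler_wpM2r ?normc_ge0.
Qed.

Lemma zsummable_reindex f (u v : int -> int) : cancel u v -> cancel v u ->
  zsummable f -> zsummable (f \o u).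
Proof.
move=> uv vu /zsummableE foo; apply/zsummableE.
rewrite (reindex_esum [set: int] _ u) in foo; first exact: foo.
split=> //.
- by move=> i j _ _ /(can_inj uv).
- by move=> i _; exists (v i).
Qed.

Lemma zsum_reindex f (u v : int -> int) : cancel u v -> cancel v u ->
  zsummable f -> zsum (f \o u) = zsum f.
Proof.
move=> uv vu fs; apply: has_zsum_zsum.
exact: has_zsum_reindex uv vu (zsummable_has_zsum fs).
Qed.

Lemma zsum_conj f : zsummable f -> zsum (fun k => (f k)^*%R) = (zsum f)^*%R.
Proof. by move=> /zsummable_has_zsum/has_zsum_conj/has_zsum_zsum. Qed.

Lemma zsumZ c f : zsummable f -> zsum (fun k => c * f k) = c * zsum f.
Proof. by move=> /zsummable_has_zsum/has_zsumZ/has_zsum_zsum. Qed.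

Lemma zsumD f g : zsummable f -> zsummable g ->
  zsum (fun k => f k + g k) = zsum f + zsum g.
Proof.
move=> /zsummable_has_zsum fs /zsummable_has_zsum gs.
exact/has_zsum_zsum/has_zsumD.
Qed.

Lemma zsum_sum (I : Type) (r : seq I) (F : I -> int -> C) :
  (forall i, zsummable (F i)) ->
  zsum (fun k => \sum_(i <- r) F i k) = \sum_(i <- r) zsum (F i).
Proof.
move=> Fs; elim: r => [|i r IH].
  rewrite big_nil; apply: has_zsum_zsum.
  have := @has_zsum_fin R (fun=> 0) fset0 (fun _ _ => erefl).
  by rewrite big1_eq; apply: eq_has_zsum => k; rewrite big_nil.
rewrite big_cons -IH -zsumD//; last exact: zsummable_sum.
by congr zsum; apply/funext => k; rewrite big_cons.
Qed.

Lemma zsum_window f (a : int) (K : nat) :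
  (forall k, ~~ (a <= k < a + K%:Z) -> f k = 0) ->
  zsum f = \sum_(i < K) f (a + i%:Z).
Proof.
move=> f0; pose s := [seq a + i%:Z | i <- iota 0 K].
have us : uniq s by rewrite map_inj_uniq ?iota_uniq// => i j /addrI[].
have -> : \sum_(i < K) f (a + i%:Z) = \sum_(k <- [fset k in s]%fset) f k.
  rewrite -(sum_iota K (fun i => f (a + i%:Z))) -(big_map (fun i : nat => a + i%:Z) xpredT).
  by apply: perm_big; apply: uniq_perm; rewrite ?fset_uniq// => k; rewrite inE.
apply/has_zsum_zsum/has_zsum_fin => k kA; apply: f0; apply: contra kA => kaK.
rewrite inE; apply/mapP; exists (absz (k - a)%R) => /=; last by lia.
by rewrite mem_iota; lia.
Qed.

Lemma zsummable_fin f (a : int) (K : nat) :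
  (forall k, ~~ (a <= k < a + K%:Z) -> f k = 0) -> zsummable f.
Proof.
move=> f0; apply/zsummableE.
pose s := [seq a + i%:Z | i <- iota 0 K].
have <- : \esum_(k in [set` s]) (normc (f k))%:E =
    \esum_(k in [set: int]) (normc (f k))%:E.
  rewrite esum_mkcond; apply: eq_esum => k _; case: ifPn => // ks.
  rewrite f0 ?normc0//; apply: contra ks => kaK; apply: mem_set => /=.
  apply/mapP; exists (absz (k - a)%R) => /=; last by lia.
  by rewrite mem_iota; lia.
have fs : finite_set [set` s] := finite_seq s.
rewrite esum_fset//; last by move=> k _; rewrite lee_fin normc_ge0.
by rewrite fsbig_finite//= sumEFin ltry.
Qed.

End Summability.

(** * Polynomials acting on sequences through the unit delay *)

Section PolynomialAction.
Context {R : realType}.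
Local Open Scope complex_scope.
Local Notation C := R[i].
Implicit Types (y : int -> C) (p q : {poly C}).

(** This is [p] evaluated at the unit delay operator and applied to [y], that is, convolution with
    the coefficients of [p]. *)
Definition poly_act p y (n : int) : C :=
  \sum_(k < size p) p`_k * y (n - k%:Z).

Lemma poly_act_widen p y N n : (size p <= N)%N ->
  poly_act p y n = \sum_(k < N) p`_k * y (n - k%:Z).
Proof.
move=> pN; rewrite /poly_act.
rewrite -!(big_mkord xpredT (fun k : nat => p`_k * y (n - k%:Z))).
rewrite [RHS](big_cat_nat (n := size p))//= [X in _ + X]big_nat_cond.
rewrite [X in _ + X]big1 ?addr0// => k /andP[/andP[pk _] _].
by rewrite nth_default ?mul0r.
Qed.

(** Multiplication by a linear factor acts as composition, ['X] being the delay; this lets the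
    factors be stripped one at a time. *)
Lemma poly_act_XsubC_mul z q y n :
  poly_act (('X - z%:P) * q) y n = poly_act q y (n - 1) - z * poly_act q y n.
Proof.
rewrite (@poly_act_widen _ _ (size q).+1); last first.
  by rewrite (leq_trans (size_polyMleq _ _))// size_XsubC.
rewrite (@poly_act_widen q y (size q).+1 n)//.
(* Multiplying [q] by ['X] shifts its coefficients and puts 0 in front, which absorbs the delay. *)
have -> : poly_act q y (n - 1) =
    \sum_(k < (size q).+1) ('X * q)`_k * y (n - k%:Z).
  rewrite big_ord_recl coefXM mul0r add0r; apply: eq_bigr => k _.
  rewrite coefXM /=; congr (_ * y _); rewrite /bump /=; lia.
rewrite mulr_sumr -sumrB; apply: eq_bigr => k _.
by rewrite mulrBl coefB coefCM mulrBl mulrA.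
Qed.

Lemma poly_act_bounded p y : bounded_signal y -> bounded_signal (poly_act p y).
Proof.
move=> [M yM]; exists (\sum_(k < size p) normc p`_k * M) => n.
rewrite (le_trans (normc_sum _ _))//; apply: ler_sum => k _.
by rewrite normcM ler_wpM2l ?normc_ge0.
Qed.

(* For [y] bounded and [|z| <> 1], comparing the sum of [|y|] over a window with
   its sum over the shifted window bounds both independently of the window. *)
Lemma zsummable_XsubC z y : normc z != 1 -> bounded_signal y ->
  zsummable (fun n => y (n - 1) - z * y n) -> zsummable y.
Proof.
move=> z1 [M yM] /zsummable_window[B fB].
pose S (a : int) K := \sum_(i < K) normc (y (a + i%:Z)).
pose T (a : int) K :=
  \sum_(i < K) normc (y (a + i%:Z - 1) - z * y (a + i%:Z)).
have M0 : 0 <= M by apply: le_trans (yM 0); exact: normc_ge0.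
(* The sums over a window and over its translate differ only by two end terms, each at most [M]. *)
have shift a K :
    \sum_(i < K) normc (y (a + i%:Z - 1)) + normc (y (a + K%:Z - 1)) =
    normc (y (a - 1)) + S a K.
  transitivity (\sum_(i < K.+1) normc (y (a + i%:Z - 1))).
    by rewrite big_ord_recr.
  rewrite big_ord_recl /= addr0; congr (_ + _); apply: eq_bigr => i _.
  by congr (normc (y _)); rewrite /bump /=; lia.
have z0 := normc_ge0 z.
have up a K : normc z * S a K <= M + S a K + B.
  apply: (@le_trans _ _ (\sum_(i < K) normc (y (a + i%:Z - 1)) + T a K)).
    rewrite /T mulr_sumr -big_split /=; apply: ler_sum => i _.
    rewrite -normcM.
    have {1}-> : z * y (a + i%:Z) =
      y (a + i%:Z - 1) + - (y (a + i%:Z - 1) - z * y (a + i%:Z)) by ring.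
    by rewrite (le_trans (normcD_le _ _))// normc_opp.
  apply: lerD; last exact: fB.
  have := shift a K; have := normc_ge0 (y (a + K%:Z - 1)); have := yM (a - 1).
  lra.
have down a K : S a K <= M + normc z * S a K + B.
  have le1 : \sum_(i < K) normc (y (a + i%:Z - 1)) <= normc z * S a K + T a K.
    rewrite /T mulr_sumr -big_split /=; apply: ler_sum => i _; rewrite -normcM.
    have {1}-> : y (a + i%:Z - 1) =
      z * y (a + i%:Z) + (y (a + i%:Z - 1) - z * y (a + i%:Z)) by ring.
    exact: normcD_le.
  have := shift a K; have := normc_ge0 (y (a - 1)); have := yM (a + K%:Z - 1).
  by have := fB a K; rewrite -/(T a K); lra.
(* The inequality [down] can be solved for [S a K] when [|z| < 1], and [up] when [|z| > 1]. *)
case: (ltgtP (normc z) 1) z1 => // z1 _.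
  apply: (@window_zsummable _ _ ((M + B) / (1 - normc z))) => a K.
  rewrite ler_pdivlMr ?subr_gt0//; have := down a K; rewrite /S; lra.
apply: (@window_zsummable _ _ ((M + B) / (normc z - 1))) => a K.
rewrite ler_pdivlMr ?subr_gt0//; have := up a K; rewrite /S; lra.
Qed.

(** Over the algebraically closed field [p] splits into linear factors. Each is removed by
    [zsummable_XsubC], applied to the sequence on which the remaining factors have acted, which is
    still bounded. *)
Lemma zsummable_poly_act p y : p != 0 ->
  (forall z, root p z -> normc z != 1) -> bounded_signal y ->
  zsummable (poly_act p y) -> zsummable y.
Proof.
have [r ->] := closed_field_poly_normal p; set c := lead_coef p.
case: (eqVneq c 0) => [->|c0]; first by rewrite scale0r eqxx.
move=> _ circle yb; have {circle} : forall z, z \in r -> normc z != 1.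
  by move=> z zr; apply: circle; rewrite rootZ// root_prod_XsubC.
elim: r => [_|z r IH zr].
  (* With no factor left, the action is multiplication by the nonzero leading coefficient. *)
  rewrite big_nil => ys; have := zsummableZ c^-1 ys; congr zsummable.
  apply/funext => n; rewrite (@poly_act_widen _ _ 1); last first.
    by rewrite (leq_trans (size_scale_leq _ _))// size_poly1.
  by rewrite big_ord1 coefZ coef1 eqxx mulr1 subr0 mulrA mulVf ?mul1r.
rewrite big_cons scalerAr => ys; apply: IH.
  by move=> t tr; apply: zr; rewrite inE tr orbT.
apply: (@zsummable_XsubC z); first by rewrite zr ?mem_head.
  exact: poly_act_bounded.
by move: ys; congr zsummable; apply/funext => n; rewrite poly_act_XsubC_mul.
Qed.

End PolynomialAction.

(** * Inverses of finitely supported proper signals *)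

Section ProperSignals.
Context {R : realType}.
Local Open Scope complex_scope.
Local Notation C := R[i].
Implicit Types (y z : int -> C).

(** The indices from 0 to [m] are those of the coefficients of [\poly_(k < m.+1) y k%:Z], which then
    determines [y]. *)
Definition supported_in m y := forall n : int, n < 0 \/ m.+1%:Z <= n -> y n = 0.

Lemma dconv_window m y z n : supported_in m y ->
  dconv y z n = \sum_(k < m.+1) y k%:Z * z (n - k%:Z).
Proof.
move=> ym; rewrite /dconv (@zsum_window _ _ 0 m.+1).
  by apply: eq_bigr => k _; rewrite add0r.
by move=> k k0; rewrite ym ?mul0r//; lia.
Qed.

Lemma dconv_defined_window m y z : supported_in m y -> dconv_defined y z.
Proof.
move=> ym n; apply: (@zsummable_fin _ _ 0 m.+1) => k k0.
by rewrite ym ?mul0r//; lia.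
Qed.

Lemma dconv_poly_act m y z n : supported_in m y ->
  dconv y z n = poly_act (\poly_(k < m.+1) y k%:Z) z n.
Proof.
move=> ym; rewrite (dconv_window _ _ ym) (@poly_act_widen _ _ _ m.+1) ?size_poly//.
by apply: eq_bigr => k _; rewrite coef_poly ltn_ord.
Qed.

Lemma proper_conv_inv y : proper_signal y -> bounded_inverse y (conv_inv y).
Proof. by move=> [_ [z [yz _]]]; rewrite /conv_inv; case: xgetP => // /(_ z). Qed.

Lemma proper_conv_inv_unique y z : proper_signal y -> bounded_inverse y z ->
  z = conv_inv y.
Proof.
move=> py yz; have yi := proper_conv_inv py.
by case: py => _ [t [_ tu]]; rewrite -(tu _ yz) -(tu _ yi).
Qed.

(* A root [a] with [|a| = 1] would make [z n + a^(-n)] a second bounded inverse. *)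
Lemma proper_root_circle m y a : supported_in m y -> proper_signal y ->
  root (\poly_(k < m.+1) y k%:Z) a -> normc a != 1.
Proof.
move=> ym py /rootP ra; apply/eqP => a1.
have a0 : a != 0 by apply/eqP => a0; move: a1; rewrite a0 normc0 => /esym/eqP; rewrite oner_eq0.
have [[M zM] zd zi] := proper_conv_inv py; set z := conv_inv y in zM zd zi.
pose u (n : int) : C := a ^ (- n).
have un n : normc (u n) = 1.
  have pown (k : nat) : normc (a ^+ k) = 1.
    by elim: k => [|k IH]; rewrite ?expr0 ?normc1// exprS normcM a1 IH mulr1.
  by rewrite /u; case: (- n) => k; rewrite ?NegzE -?exprnN ?normcV pown// invr1.
(* Convolution with [y] multiplies the geometric sequence [u] by the value at [a] of the polynomial
   of [y], here 0. *)
have yu n : dconv y u n = 0.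
  rewrite (dconv_window _ _ ym).
  transitivity (u n * (\poly_(k < m.+1) y k%:Z).[a]); last by rewrite ra mulr0.
  rewrite horner_poly mulr_sumr; apply: eq_bigr => k _.
  by rewrite /u opprB expfzDr// mulrA mulrC.
have : z + u = z.
  apply: proper_conv_inv_unique => //; split.
  - exists (M + 1) => n; rewrite (le_trans (normcD_le _ _))// un lerD2r.
    exact: zM.
  - exact: dconv_defined_window ym.
  - rewrite -zi; apply/funext => n.
    rewrite -[RHS]addr0 -(yu n) !(dconv_window _ _ ym) -big_split.
    by apply: eq_bigr => k _; rewrite mulrDr.
move=> /(congr1 (fun f => f 0)) /eqP; rewrite -subr_eq0 addrC addKr => /eqP u0.
by have := un 0; rewrite u0 normc0 => /esym/eqP; rewrite oner_eq0.
Qed.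

(** The polynomial of [y] sends the inverse to the unit impulse, which is summable, and it has no
    root on the unit circle; hence [zsummable_poly_act] applies. *)
Lemma zsummable_conv_inv m y : supported_in m y -> proper_signal y ->
  zsummable (conv_inv y).
Proof.
move=> ym py; have [zb _ zi] := proper_conv_inv py.
apply: (@zsummable_poly_act _ (\poly_(k < m.+1) y k%:Z)) => //.
(* The polynomial is nonzero, since otherwise the impulse would vanish at 0. *)
- apply/eqP => P0; have : dconv y (conv_inv y) 0 = 1 by rewrite zi.
  rewrite (dconv_poly_act _ _ ym) P0 /poly_act size_poly0 big_ord0 => /esym/eqP.
  by rewrite oner_eq0.
- by move=> a; exact: proper_root_circle.
have -> : poly_act (\poly_(k < m.+1) y k%:Z) (conv_inv y) = fun n => (n == 0)%:R.
  by rewrite -zi; apply/funext => n; rewrite (dconv_poly_act _ _ ym).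
by apply: (@zsummable_fin _ _ 0 1) => k; case: eqP => // ->.
Qed.

End ProperSignals.

(** * Algebra of discrete convolution and conjugate reversal *)

Section Convolution.
Context {R : realType}.
Local Open Scope complex_scope.
Local Notation C := R[i].
Implicit Types (p y z t x : int -> C).

Lemma conj_revK (T : zmodType) (y : T -> C) : conj_rev (conj_rev y) = y.
Proof. by apply/funext => k; rewrite /conj_rev opprK conjCK. Qed.

Lemma normc_conj_rev (T : zmodType) (y : T -> C) k :
  normc (conj_rev y k) = normc (y (- k)).
Proof. exact: normc_conj. Qed.

Lemma bounded_conj_rev (T : zmodType) (y : T -> C) :
  bounded_signal y -> bounded_signal (conj_rev y).
Proof. by move=> [M yM]; exists M => k; rewrite normc_conj_rev. Qed.

(** The substitution of [-k] for [k] reduces the compatibility of reversal with convolution to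
    reindexing and conjugating a sum. *)
Lemma conj_rev_dconv_term y z n :
  (fun k => conj_rev y k * conj_rev z (n - k)) =
  (fun k => (y k * z (- n - k))^*%R) \o -%R.
Proof.
apply/funext => k; rewrite /= /conj_rev rmorphM; congr (_ * (z _)^*%R); lia.
Qed.

Lemma zsummable_conj (f : int -> C) :
  zsummable f -> zsummable (fun k => (f k)^*%R).
Proof. by apply: zsummable_normc => k; rewrite normc_conj. Qed.

Lemma dconv_defined_conj_rev y z :
  dconv_defined y z -> dconv_defined (conj_rev y) (conj_rev z).
Proof.
move=> yz n; rewrite conj_rev_dconv_term.
exact: (zsummable_reindex (@opprK _) (@opprK _) (zsummable_conj (yz _))).
Qed.

Lemma dconv_conj_rev y z : dconv_defined y z ->
  dconv (conj_rev y) (conj_rev z) = conj_rev (dconv y z).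
Proof.
move=> yz; apply/funext => n; rewrite /dconv conj_rev_dconv_term.
rewrite (zsum_reindex (@opprK _) (@opprK _) (zsummable_conj (yz _))).
by rewrite (zsum_conj (yz _)).
Qed.

Lemma dconvC y z : dconv_defined y z -> dconv z y = dconv y z.
Proof.
move=> yz; apply/funext => n.
have nK : cancel (fun k => n - k) (fun k => n - k) by move=> k; lia.
rewrite /dconv -(zsum_reindex nK nK (yz n)); congr zsum.
by apply/funext => k /=; rewrite mulrC; congr (y _ * z _); lia.
Qed.

Lemma dconv_definedC y z : dconv_defined y z -> dconv_defined z y.
Proof.
move=> yz n.
have nK : cancel (fun k => n - k) (fun k => n - k) by move=> k; lia.
have := zsummable_reindex nK nK (yz n); congr zsummable.
by apply/funext => k /=; rewrite mulrC; congr (z _ * y _); lia.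
Qed.

Lemma dconv_delta y : dconv (fun n => (n == 0)%:R) y = y.
Proof.
apply/funext => n; rewrite /dconv (@zsum_window _ _ 0 1).
  by rewrite big_ord1 addr0 eqxx mul1r subr0.
by move=> k; case: eqP => [->//|_ _]; rewrite mul0r.
Qed.

Lemma zsummable_dconv y z : zsummable y -> bounded_signal z -> dconv_defined y z.
Proof.
move=> ys [M zM] n; apply: (@zsummable_bounded _ y (fun k => z (n - k))) => //.
by exists M => k.
Qed.

(** Once the inner index is shifted, both sides are iterated sums of a single double family; the
    last hypothesis is its absolute convergence, and Fubini concludes. *)
Lemma dconvA y z t n : dconv_defined y z -> dconv_defined z t ->
  (\esum_(k in [set: int]) \esum_(l in [set: int])
     (normc (y k * (z (l - k) * t (n - l))))%:E < +oo)%E ->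
  dconv y (dconv z t) n = dconv (dconv y z) t n.
Proof.
move=> yz zt oo.
have shift k : dconv z t (n - k) = zsum (fun l => z (l - k) * t (n - l)).
  have kK : cancel (fun l => l - k) (fun l => l + k) by move=> l; rewrite subrK.
  have kK' : cancel (fun l => l + k) (fun l => l - k) by move=> l; rewrite addrK.
  rewrite /dconv -(zsum_reindex kK kK' (zt _)); congr zsum.
  by apply/funext => l /=; congr (_ * t _); lia.
have shiftS k : zsummable (fun l => z (l - k) * t (n - l)).
  have kK : cancel (fun l => l - k) (fun l => l + k) by move=> l; rewrite subrK.
  have kK' : cancel (fun l => l + k) (fun l => l - k) by move=> l; rewrite addrK.
  have := zsummable_reindex kK kK' (zt (n - k)); congr zsummable.
  by apply/funext => l /=; congr (_ * t _); lia.
transitivity (zsum (fun k => zsum (fun l => y k * (z (l - k) * t (n - l))))).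
  by congr zsum; apply/funext => k; rewrite shift zsumZ.
rewrite zsum_exchange//; congr zsum; apply/funext => l.
rewrite /dconv mulrC -(zsumZ _ (yz l)); congr zsum.
by apply/funext => k; ring.
Qed.

(** A summable outer factor, with inner sums bounded uniformly in [k], yields the absolute
    convergence that [dconvA] asks for. *)
Lemma esum_dconvA_lty y z t n (B : R) : 0 <= B -> zsummable y ->
  (forall k a K, \sum_(i < K) normc (z (a + i%:Z - k) * t (n - (a + i%:Z))) <= B) ->
  (\esum_(k in [set: int]) \esum_(l in [set: int])
     (normc (y k * (z (l - k) * t (n - l))))%:E < +oo)%E.
Proof.
move=> B0 ys ztB; apply: le_lt_trans (esum_mulC_lty ys B0).
apply: le_esum => k _; apply: esum_window_le => [l|a K]; first exact: normc_ge0.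
under eq_bigr do rewrite normcM.
by rewrite -mulr_sumr mulrC ler_wpM2r ?normc_ge0.
Qed.

(** The sum over [p] is finite and therefore passes through the infinite one by linearity. *)
Lemma dconvA_window m p y z : supported_in m p -> dconv_defined y z ->
  dconv p (dconv y z) = dconv (dconv p y) z.
Proof.
move=> pm yz; apply/funext => n.
have kK (k : int) : cancel (fun l => l - k) (fun l => l + k).
  by move=> l; rewrite subrK.
have kK' (k : int) : cancel (fun l => l + k) (fun l => l - k).
  by move=> l; rewrite addrK.
have shiftE (k : int) : (fun l => y l * z (n - k - l)) \o (fun l => l - k) =
    (fun l => y (l - k) * z (n - l)).
  by apply/funext => l /=; congr (_ * z _); lia.
have shiftS (k : int) : zsummable (fun l => y (l - k) * z (n - l)).
  by rewrite -shiftE; exact: zsummable_reindex (kK' k) (yz _).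
rewrite (dconv_window _ _ pm).
transitivity (\sum_(k < m.+1) zsum (fun l => p k%:Z * (y (l - k%:Z) * z (n - l)))).
  apply: eq_bigr => k _; rewrite zsumZ//; congr (_ * _).
  by rewrite -shiftE (zsum_reindex (kK _) (kK' _)).
rewrite -zsum_sum; last by move=> k; exact: zsummableZ.
congr zsum; apply/funext => l; rewrite (dconv_window _ _ pm) mulr_suml.
by apply: eq_bigr => k _; rewrite mulrA.
Qed.

Lemma bounded_inverse_conj_rev y z :
  bounded_inverse y z -> bounded_inverse (conj_rev y) (conj_rev z).
Proof.
move=> [zb yz yzE]; split.
- exact: bounded_conj_rev.
- exact: dconv_defined_conj_rev.
- rewrite dconv_conj_rev// yzE; apply/funext => n.
  by rewrite /conj_rev oppr_eq0 rmorph_nat.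
Qed.

(** [conj_rev] is an involution that carries bounded inverses to bounded inverses, so uniqueness
    transfers as well. *)
Lemma proper_conj_rev y : proper_signal y -> proper_signal (conj_rev y).
Proof.
move=> [yb [z [yz zu]]]; split; first exact: bounded_conj_rev.
exists (conj_rev z); split; first exact: bounded_inverse_conj_rev.
move=> z' /bounded_inverse_conj_rev; rewrite conj_revK => /zu ->.
by rewrite conj_revK.
Qed.

Lemma conv_inv_conj_rev y : proper_signal y ->
  conv_inv (conj_rev y) = conj_rev (conv_inv y).
Proof.
move=> py; apply/esym/proper_conv_inv_unique; first exact: proper_conj_rev.
exact/bounded_inverse_conj_rev/proper_conv_inv.
Qed.

Lemma zsummable_conj_rev y : zsummable y -> zsummable (conj_rev y).
Proof.
move=> /(zsummable_reindex (@opprK _) (@opprK _)).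
by apply: zsummable_normc => k; rewrite normc_conj_rev.
Qed.

(** Reversal swaps the two factors, and commutativity swaps them back. *)
Lemma dconv_autocorrelation_conj_rev x : dconv_defined x (conj_rev x) ->
  conj_rev (dconv x (conj_rev x)) = dconv x (conj_rev x).
Proof. by move=> xx; rewrite -dconv_conj_rev// conj_revK dconvC. Qed.

(* [x] is square summable, by its autocorrelation at 0, so that the inner sums
   of the triple convolution are uniformly bounded. *)
Lemma dconvA_autocorrelation y x : zsummable y -> dconv_defined x (conj_rev x) ->
  dconv_defined y (conj_rev x) ->
  dconv y (dconv x (conj_rev x)) = dconv (dconv y (conj_rev x)) x.
Proof.
move=> ys xx yx; apply/funext => n.
have sq : zsummable (fun k => x k * x k).
  by apply: zsummable_normc (xx 0) => k; rewrite !normcM normc_conj_rev sub0r opprK.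
have [B xB] : exists B : R, forall (a : int) (K : nat),
    \sum_(i < K) normc (conj_rev x (a + i%:Z)) ^+ 2 <= B.
  have [B xB] := zsummable_window (zsummable_conj_rev sq).
  exists B => a K; apply: le_trans (xB a K).
  by apply: ler_sum => i _; rewrite !normc_conj_rev normcM.
have [D xD] : exists D : R, forall (a : int) (K : nat),
    \sum_(i < K) normc (x (n - (a + i%:Z))) ^+ 2 <= D.
  have nK : cancel (fun k => n - k) (fun k => n - k) by move=> k; lia.
  have [D xD] := zsummable_window (zsummable_reindex nK nK sq).
  exists D => a K; apply: le_trans (xD a K).
  by apply: ler_sum => i _; rewrite /= normcM.
have B0 : 0 <= B by have := xB 0 0%N; rewrite big_ord0.
have D0 : 0 <= D by have := xD 0 0%N; rewrite big_ord0.
rewrite -(dconvC xx); apply: dconvA => //; first exact: dconv_definedC.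
apply: (esum_dconvA_lty (addr_ge0 B0 D0)) => // k a K.
(* A product of two moduli is at most the sum of their squares, whose window sums are bounded by [B]
   and [D]. *)
apply: le_trans (lerD (xB (a - k) K) (xD a K)).
rewrite -big_split; apply: ler_sum => i _; rewrite normcM /=.
rewrite (_ : a + i%:Z - k = a - k + i%:Z); last by lia.
set u := normc _; set v := normc _.
have u0 : 0 <= u := normc_ge0 _; have v0 : 0 <= v := normc_ge0 _.
nra.
Qed.

(** Commutativity brings [p] next to [conv_inv p], where they cancel to the impulse; the regrouping
    is [dconvA_window]. What remains is the inverse of [conj_rev p] against the autocorrelation of
    [x], regrouped by [dconvA_autocorrelation]. *)
Lemma dconv_deconvolution m p x : supported_in m p -> proper_signal p ->
  dconv_defined x (conj_rev x) ->
  dconv_defined (dconv x (conj_rev x))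
    (dconv (conv_inv p) (conv_inv (conj_rev p))) ->
  dconv_defined (conv_inv (conj_rev p)) (conj_rev x) ->
  dconv p (dconv (dconv x (conj_rev x))
             (dconv (conv_inv p) (conv_inv (conj_rev p)))) =
  dconv (dconv (conv_inv (conj_rev p)) (conj_rev x)) x.
Proof.
move=> pm pp xx ab gx.
have [hb ph phE] := proper_conv_inv pp.
have hs := zsummable_conv_inv pm pp.
have gE := conv_inv_conj_rev pp; set g := conv_inv (conj_rev p) in gE ab gx *.
have gs : zsummable g by rewrite gE; exact: zsummable_conj_rev.
have gb : bounded_signal g by rewrite gE; exact: bounded_conj_rev.
rewrite -(dconvC ab) (dconvA_window pm (dconv_definedC ab)).
rewrite (dconvA_window pm (zsummable_dconv hs gb)) phE dconv_delta.
exact: dconvA_autocorrelation.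
Qed.

(** The sequence is a convolution of two autocorrelations, those of [x] and of [conv_inv p], and
    each is invariant under [conj_rev]. This symmetry is what makes the Toeplitz matrix
    Hermitian. *)
Lemma conj_rev_deconvolution m p x : supported_in m p -> proper_signal p ->
  dconv_defined x (conj_rev x) ->
  dconv_defined (dconv x (conj_rev x))
    (dconv (conv_inv p) (conv_inv (conj_rev p))) ->
  conj_rev (dconv (dconv x (conj_rev x))
             (dconv (conv_inv p) (conv_inv (conj_rev p)))) =
  dconv (dconv x (conj_rev x)) (dconv (conv_inv p) (conv_inv (conj_rev p))).
Proof.
move=> pm pp xx ab; have [hb _ _] := proper_conv_inv pp.
rewrite -dconv_conj_rev// dconv_autocorrelation_conj_rev//.
rewrite conv_inv_conj_rev// dconv_autocorrelation_conj_rev//.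
exact: zsummable_dconv (zsummable_conv_inv pm pp) (bounded_conj_rev hb).
Qed.

End Convolution.

(** * Cutting the time axis into unit intervals *)

Section TimeSlices.
Context {R : realType}.
Local Open Scope complex_scope.
Local Notation C := R[i].

(** As [f] lives on [(0, m + 1)] and [t] in [[0, 1)], the term of index [n] survives only for
    [i - m <= n <= i]; then [n = i - j] gives the row of the matrix. *)
Lemma train_conv_time_slice m (v : int -> C) (f : R -> C) (i : 'I_m.+1) (t : R) :
  (forall t : R, ~~ (0 < t < m.+1%:R) -> f t = 0) -> 0 <= t < 1 ->
  train_conv v f (t + i%:R) =
  \sum_(j < m.+1) v (i%:Z - j%:Z) * time_slice f j t.
Proof.
move=> f0 t01; rewrite /train_conv (@zsum_window _ _ (i%:Z - m%:Z) m.+1).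
  (* The window runs upwards from [i - m], whereas [j = i - n] runs downwards. *)
  rewrite (reindex_inj rev_ord_inj); apply: eq_bigr => j _.
  rewrite /time_slice t01 /=; have jm : (j <= m)%N by rewrite -ltnS.
  have -> : i%:Z - m%:Z + (m.+1 - j.+1)%N%:Z = i%:Z - j%:Z by lia.
  by congr (_ * f _); rewrite rmorphB /= -!pmulrn; ring.
move=> k ki; rewrite f0 ?mulr0//; apply: contra ki => /andP[fk kf].
case/andP: t01 => t0 t1.
have : (k < i%:Z + 1).
  rewrite -(ltr_int R) rmorphD /= -pmulrn; lra.
have : (i%:Z - m%:Z - 1 < k).
  rewrite -(ltr_int R) !rmorphB /= -!pmulrn; move: kf; rewrite -natr1; lra.
lia.
Qed.

(** Inside the support, [t] lies in exactly one interval [[n, n + 1)], the one given by its integer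
    part, so a single slice contributes. *)
Lemma sum_time_slice m (f : R -> C) (t : R) :
  (forall t : R, ~~ (0 < t < m.+1%:R) -> f t = 0) ->
  f t = \sum_(n < m.+1) time_slice f n (t - n%:R).
Proof.
move=> f0; have [tm|tm] := boolP (0 < t < m.+1%:R); last first.
  rewrite big1 ?f0// => n _; rewrite /time_slice subrK f0//.
  by case: ifP.
have /andP[t0 tm1] := tm.
have /andP[it ti] := truncn_itv (ltW t0); set i := Num.truncn t in it ti.
have im : (i < m.+1)%N by rewrite -(ltr_nat R); exact: le_lt_trans tm1.
rewrite (bigD1 (Ordinal im))//= big1 ?addr0 => [|n ni].
  rewrite /time_slice subrK ifT// subr_ge0 it ltrBlDr.
  by rewrite addrC natr1.
rewrite /time_slice ifF//; apply: contra_neqF ni => /andP[nt tn].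
apply: val_inj => /=; apply/eqP; rewrite eqn_leq -ltnS -(ltnS i) -!(ltr_nat R).
move: nt tn; rewrite subr_ge0 ltrBlDr addrC natr1 => nt tn.
by rewrite (le_lt_trans nt ti) (le_lt_trans it tn).
Qed.

End TimeSlices.

(** * Passage between the functional equation and the Toeplitz system *)

Theorem mainTheorem2 (R : realType) (m : nat) (x : R -> R[i])
    (rho_d : int -> R[i]) (rho : R -> R[i]) :
  (0 < m)%N ->
  proper_signal rho_d ->
  (forall n : int, n <= 0 \/ m.+1%:Z <= n -> rho_d n = 0) ->
  chi m rho_d rho ->
  let x_d := samples x in
  let rho_inv := conv_inv rho_d in
  let rhobar_inv := conv_inv (conj_rev rho_d) in
  dconv_defined x_d (conj_rev x_d) ->
  dconv_defined (dconv x_d (conj_rev x_d)) (dconv rho_inv rhobar_inv) ->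
  dconv_defined rhobar_inv (conj_rev x_d) ->
  train_conv_defined (dconv rhobar_inv (conj_rev x_d)) x ->
  let v_d := dconv (dconv x_d (conj_rev x_d)) (dconv rho_inv rhobar_inv) in
  let w := train_conv (dconv rhobar_inv (conj_rev x_d)) x in
  let V := toeplitz m v_d in
  [/\ (forall t : R, 0 < t < m.+1%:R -> train_conv v_d rho t = w t) <->
      (forall t : R,
         V *m (\col_n time_slice rho n t) = \col_n time_slice w n t),
      V \is hermsymmx
    & forall t : R, rho t = \sum_(n < m.+1) time_slice rho n (t - n%:R)].
Proof.
move=> _ pp rho0 [_ rhoE rho_supp] x_d rho_inv rhobar_inv xx ab gx _ v_d w V.
have pm : supported_in m rho_d.
  by move=> n nm; apply: rho0; case: nm => [/ltW|]; [left|right].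
(* The system contains one equation, at [t = 0] in row 0, that lies outside
   [(0, m + 1)]; it holds by associativity of the convolutions. *)
have at0 : train_conv v_d rho 0 = w 0.
  have := congr1 (fun f => f 0) (dconv_deconvolution pm pp xx ab gx).
  rewrite -/rho_inv -/rhobar_inv -/v_d.
  have -> : w 0 = dconv (dconv rhobar_inv (conj_rev x_d)) x_d 0.
    congr zsum; apply/funext => k.
    by rewrite /x_d /samples !sub0r rmorphN.
  move=> <-; rewrite -(dconvC (dconv_defined_window v_d pm)).
  congr zsum; apply/funext => k; congr (_ * _); rewrite !sub0r.
  (* Membership in [chi] matches [rho] with [rho_d] at natural numbers only; at negative integers
     both vanish, each by its own support condition. *)
  have [k0|k0] := leP k 0.
    have -> : k = - (absz k)%:Z by lia.
    by rewrite opprK -rhoE rmorphN /= opprK -pmulrn.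
  rewrite rho0; last by left; lia.
  rewrite rho_supp// negb_and -leNgt oppr_le0 ler0z ltW//.
have rowE (t : R) (i : 'I_m.+1) : 0 <= t < 1 ->
    (V *m (\col_n time_slice rho n t)) i 0 = train_conv v_d rho (t + i%:R).
  move=> t01; rewrite (train_conv_time_slice _ _ rho_supp t01) mxE.
  by apply: eq_bigr => j _; rewrite !mxE.
split.
- split=> [eqw t|sys t /andP[t0 tm]].
    (* Off [[0, 1)] every slice is 0 and the system is trivial. *)
    have [t01|t01] := boolP (0 <= t < 1); last first.
      have sl0 (f : R -> R[i]) : \col_(n < m.+1) time_slice f n t = 0.
        by apply/matrixP => i j; rewrite !mxE /time_slice (negbTE t01).
      by rewrite !sl0 mulmx0.
    apply/matrixP => i j; rewrite ord1 rowE// mxE /time_slice t01.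
    have /andP[t0 t1] := t01.
    (* The sum [t + i] is 0 only for row 0 at [t = 0], which is [at0]; otherwise it lies in
       [(0, m + 1)]. *)
    have [ti0|ti0] := eqVneq (t + i%:R) 0; first by rewrite ti0.
    apply: eqw; rewrite lt_neqAle eq_sym ti0 addr_ge0//=.
    rewrite (@lt_le_trans _ _ (1 + i%:R))// ?ltrD2r//.
    by rewrite addrC natr1 ler_nat.
  (* Write [t] as its integer part [i] plus a remainder in [[0, 1)]: row [i] of the system at the
     remainder is the equation at [t]. *)
  have /andP[it ti] := truncn_itv (ltW t0).
  set i := Num.truncn t in it ti.
  have im : (i < m.+1)%N by rewrite -(ltr_nat R); exact: le_lt_trans tm.
  have s01 : 0 <= t - i%:R < 1 by rewrite subr_ge0 it ltrBlDr addrC natr1.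
  have := congr1 (fun A : 'cV_m.+1 => A (Ordinal im) 0) (sys (t - i%:R)).
  by rewrite rowE// mxE /time_slice s01 subrK.
- have vE : conj_rev v_d = v_d := conj_rev_deconvolution pm pp xx ab.
  apply/is_hermitianmxP; rewrite expr0 scale1r; apply/matrixP => i j.
  by rewrite !mxE -[in LHS]vE /conj_rev opprB.
- by move=> t; exact: sum_time_slice.
Qed.
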